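(* If $G$ is a finite simple connected graph with at least two vertices, then $o(G\circ P_5)=\mathcal{S}$ and $S_{\rm MB}'(G\circ P_5)=S_{\rm MB}(G\circ P_5)=3$.
   Context: $P_5$ is the path on $5$ vertices. The lexicographic product $G\circ H$ has vertex set $V(G)\times V(H)$, with $(g,h)(g',h')$ an edge iff $gg'\in E(G)$, or $g=g'$ and $hh'\in E(H)$. A set $W\subseteq V(X)$ is a resolving set of a connected graph $X$ if for every two distinct vertices $x,y$ there is $z\in W$ with $d(x,z)\ne d(y,z)$. In the Maker-Breaker resolving game on $X$, Resolver and Spoiler alternately select unplayed vertices of $X$; Resolver wins if the vertices he selects contain a resolving set of $X$, and Spoiler wins if she selects at least one vertex of every resolving set of $X$. The R-game has Resolver moving first; the S-game has Spoiler moving first. $o(X)=\mathcal{S}$ means Spoiler has a winning strategy no matter who starts. $S_{\rm MB}(X)$ (resp. $S_{\rm MB}'(X)$) is the minimum number of moves Spoiler needs to win the R-game (resp. S-game) under optimal play of both players. *)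

(* Defs.v *)
From mathcomp Require Import all_boot.
From mathcomp Require Import boolp.

Set Implicit Arguments.
Unset Strict Implicit.
Unset Printing Implicit Defensive.

(* The least n satisfying P, or None (standing for infinity) if there is none. *)
Definition least (P : nat -> Prop) : option nat :=
  match pselect (exists n, `[< P n >]) with
  | left exP => Some (ex_minn exP)
  | right _ => None
  end.

Record sgraph := SGraph {
  vertex :> finType;
  edge : rel vertex;
  edge_sym : symmetric edge;
  edge_irrefl : irreflexive edge }.

Definition connected_graph (G : sgraph) : Prop :=
  forall x y : G, connect (@edge G) x y.

Definition dist (G : sgraph) (x y : G) : option nat :=
  least (fun n => exists p : seq G,
    [/\ size p = n, path (@edge G) x p & last x p = y]).

Section PathGraph.
Variable n : nat.

Definition path_edge : rel 'I_n := fun i j => (i.+1 == j :> nat) || (j.+1 == i :> nat).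

Lemma path_edge_sym : symmetric path_edge.
Proof. by move=> i j; rewrite /path_edge orbC. Qed.

Lemma path_edge_irrefl : irreflexive path_edge.
Proof. by move=> i; rewrite /path_edge orbb gtn_eqF. Qed.

Definition path_graph : sgraph := SGraph path_edge_sym path_edge_irrefl.

End PathGraph.

Section LexicographicProduct.
Variables G H : sgraph.

Definition lex_edge : rel (G * H) := fun u v =>
  edge u.1 v.1 || (u.1 == v.1) && edge u.2 v.2.

Lemma lex_edge_sym : symmetric lex_edge.
Proof. by move=> u v; rewrite /lex_edge edge_sym eq_sym (edge_sym u.2). Qed.

Lemma lex_edge_irrefl : irreflexive lex_edge.
Proof. by move=> u; rewrite /lex_edge !edge_irrefl andbF. Qed.

Definition lexprod : sgraph := SGraph lex_edge_sym lex_edge_irrefl.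

End LexicographicProduct.

Definition resolving (X : sgraph) (W : {set X}) : Prop :=
  forall x y : X, x <> y -> exists2 z, z \in W & dist x z <> dist y z.

Variant player := Resolver | Spoiler.

Definition opponent (a : player) : player :=
  if a is Resolver then Spoiler else Resolver.

Section Game.
Variables (X : sgraph) (first : player).

(* A history (or play) lists the selected vertices in chronological order. *)

Definition mover (h : seq X) : player :=
  if odd (size h) then opponent first else first.

Definition legal_strategy (sigma : seq X -> X) : Prop :=
  forall h : seq X, uniq h -> size h < #|X| -> sigma h \notin h.

Definition complete_play (p : seq X) : Prop := uniq p /\ size p = #|X|.

Definition spoiler_follows (sigma : seq X -> X) (p : seq X) : Prop :=
  forall h x t, p = h ++ x :: t -> mover h = Spoiler -> x = sigma h.

Fixpoint spoiler_moves_from (a : player) (p : seq X) : seq X :=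
  if p is x :: p' then
    let s := spoiler_moves_from (opponent a) p' in
    if a is Spoiler then x :: s else s
  else [::].

Definition spoiler_moves (p : seq X) : seq X := spoiler_moves_from first p.

Definition spoiler_won (s : seq X) : Prop :=
  forall W : {set X}, resolving W -> exists2 z, z \in s & z \in W.

(* Plays are continued until all vertices are selected. This does not affect
   the winner: a set meeting every resolving set precludes Resolver's win at
   any stage, and Spoiler's win is preserved by further moves. *)
Definition spoiler_has_winning_strategy : Prop :=
  exists2 sigma : seq X -> X, legal_strategy sigma &
    forall p, complete_play p -> spoiler_follows sigma p ->
      spoiler_won (spoiler_moves p).

Definition spoiler_wins_within (k : nat) : Prop :=
  exists2 sigma : seq X -> X, legal_strategy sigma &
    forall p, complete_play p -> spoiler_follows sigma p ->
      spoiler_won (take k (spoiler_moves p)).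

(* Only Spoiler's own moves are counted; None if Spoiler cannot force a win. *)
Definition spoiler_number : option nat := least spoiler_wins_within.

End Game.

Definition outcome_S (X : sgraph) : Prop :=
  forall first : player, spoiler_has_winning_strategy X first.

Definition S_MB (X : sgraph) : option nat := spoiler_number X Resolver.
Definition S_MB' (X : sgraph) : option nat := spoiler_number X Spoiler.

(* Main.v *)
Require Import Defs.
From mathcomp Require Import all_boot.
From mathcomp Require Import boolp.

Set Implicit Arguments.
Unset Strict Implicit.
Unset Printing Implicit Defensive.

(** Spoiler wins as soon as she owns every vertex resolving some pair [x, y].
    Two vertices [(g, h)], [(g, h')] of one layer are resolved only inside that
    layer, by [h], [h'] and the vertices adjacent to exactly one of them. In
    [P_5 = 0-1-2-3-4] the pairs 01, 02, 24, 34 are resolved exactly by the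
    triples 012, 023, 124, 234, that is, by 2 together with an edge of the
    4-cycle 0-1-4-3. Spoiler starts with 2 in a layer untouched by Resolver,
    then takes the cycle vertex opposite to Resolver's answer, and thereby
    threatens two edges at once. Two moves never suffice, since every pair
    [x, y] is resolved by [x], by [y] and by some third vertex. *)

(** * Least numbers *)

Lemma least_eq (P : nat -> Prop) n :
  P n -> (forall m, P m -> n <= m) -> least P = Some n.
Proof.
move=> Pn minP; rewrite /least; case: pselect => [exP|[]]; last first.
  by exists n; apply/asboolP.
case: ex_minnP => m /asboolP Pm minm; congr Some.
by apply/eqP; rewrite eqn_leq minP // minm //; apply/asboolP.
Qed.

(** Serves to compare two distances by replacing walks with walks that are no longer, instead of
    equally long; the case where both values are [None] is covered. *)
Lemma least_mono (P Q : nat -> Prop) :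
  (forall n, P n -> exists2 m, m <= n & Q m) ->
  (forall n, Q n -> exists2 m, m <= n & P m) -> least P = least Q.
Proof.
move=> PQ QP; rewrite {2}/least; case: pselect => [exQ|nQ].
  case: ex_minnP => m /asboolP Qm minm.
  have minP k : P k -> m <= k.
    by move=> /PQ[j le_jk Qj]; apply: leq_trans le_jk; apply/minm/asboolP.
  have [j le_jm Pj] := QP _ Qm.
  by apply: least_eq => //; have/eqP-> : m == j by rewrite eqn_leq minP.
rewrite /least; case: pselect => // exP; case: nQ; case: exP => n /asboolP Pn.
by have [m _ Qm] := PQ _ Pn; exists m; apply/asboolP.
Qed.

(** * Distances and resolving sets *)

Section Distance.
Variable X : sgraph.
Implicit Types x y z : X.

Lemma distxx x : dist x x = Some 0.
Proof. by apply: least_eq => //; exists [::]. Qed.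

Lemma dist_edge x y : edge x y -> dist x y = Some 1.
Proof.
move=> exy; apply: least_eq => [|[|//]].
  by exists [:: y]; rewrite /= exy.
case=> -[|u p] [//= _ _ xy].
by move: exy; rewrite xy edge_irrefl.
Qed.

Lemma dist_common_neighbor x y z :
  x != y -> ~~ edge x y -> edge x z -> edge z y -> dist x y = Some 2.
Proof.
move=> xy nexy exz ezy; apply: least_eq => [|[|[|//]]].
- by exists [:: z; y]; rewrite /= exz ezy.
- by case=> -[|u p] [//= _ _ Exy]; rewrite Exy eqxx in xy.
case=> -[|u [|v p]] [//= _]; rewrite andbT => exu Euy.
by rewrite Euy (negPf nexy) in exu.
Qed.

Lemma dist_witness x y n :
  dist x y = Some n ->
  exists p, [/\ size p = n, path (@edge X) x p & last x p = y].
Proof.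
rewrite /dist /least; case: pselect => // exP [<-].
by case: ex_minnP => m /asboolP.
Qed.

Lemma dist_eq0 x y : dist x y = Some 0 -> x = y.
Proof. by case/dist_witness=> -[|u p] []. Qed.

Lemma dist_eq1 x y : dist x y = Some 1 -> edge x y.
Proof. by case/dist_witness=> -[|u [|v p]] [//= _]; rewrite andbT => ? <-. Qed.

(** Exactly one of the two distances is [Some 1]. *)
Lemma neq_edge_neq_dist x y z : edge x z != edge y z -> dist x z <> dist y z.
Proof.
case exz: (edge x z); case eyz: (edge y z) => // _ dxy.
  by move: dxy; rewrite dist_edge // => /esym/dist_eq1; rewrite eyz.
by move: dxy; rewrite (dist_edge eyz) => /dist_eq1; rewrite exz.
Qed.

Lemma exists_neighbor x :
  connected_graph X -> 2 <= #|X| -> exists y, edge x y.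
Proof.
move=> conX /card_gt1P[a [b [_ _ ab]]].
have [y xy]: exists y, y != x.
  by case: (eqVneq a x) ab => [->|ax _]; [exists b; rewrite eq_sym | exists a].
case/connectP: (conX x y) => -[/= _ Eyx|u p /= /andP[exu _] _].
  by rewrite Eyx eqxx in xy.
by exists u.
Qed.

(** Each pair is resolved by three vertices, [x], [y] and the third one supplied by the hypothesis;
    a list of size at most 2 misses one of them. *)
Lemma setC_resolving (s : seq X) :
  (forall x y, x != y ->
    exists z, [/\ z != x, z != y & edge x z != edge y z]) ->
  size s <= 2 -> resolving [set z | z \notin s].
Proof.
move=> third les x y /eqP xy.
have [xs|xs] := boolP (x \in s); last first.
  by exists x; rewrite ?inE // distxx => /esym/dist_eq0 yx;
    rewrite yx eqxx in xy.
have [ys|ys] := boolP (y \in s); last first.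
  by exists y; rewrite ?inE // distxx => /dist_eq0 yx; rewrite yx eqxx in xy.
have [z [zx zy ez]] := third _ _ xy.
exists z; last exact: neq_edge_neq_dist.
rewrite inE; apply/negP => zs.
have /uniq_leq_size : uniq [:: x; y; z].
  by rewrite /= !inE negb_or xy eq_sym zx eq_sym zy.
move=> /(_ s) le3; have: 3 <= size s.
  by apply: le3 => u; rewrite !inE => /or3P[]/eqP->.
by rewrite leqNgt ltnS les.
Qed.

End Distance.

(** * Strategies and plays *)

Section Play.
Variables (X : sgraph) (first : player).
Implicit Types (h p : seq X) (sigma : seq X -> X).

(** Falls back to some unplayed vertex, so that any plan becomes a legal strategy; the default [x]
    is reached only on a full board. *)
Definition legal_move h (x : X) : X :=
  if x \notin h then x else odflt x [pick y | y \notin h].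

Lemma exists_notin h : size h < #|X| -> exists y, y \notin h.
Proof.
move=> lth; have [y yh|all_h] := pickP [pred y | y \notin h]; first by exists y.
suff: #|X| <= size h by rewrite leqNgt lth.
apply: leq_trans (card_size h); apply: subset_leq_card.
by apply/subsetP => y _; apply: negbFE (all_h y).
Qed.

Lemma legal_move_legal (f : seq X -> X) :
  legal_strategy (fun h => legal_move h (f h)).
Proof.
move=> h _ lth; rewrite /legal_move; case: ifP => // _.
case: pickP => [y //|all_h].
by have [y yh] := exists_notin lth; have := all_h y; rewrite yh.
Qed.

Lemma legal_move_id h x : x \notin h -> legal_move h x = x.
Proof. by rewrite /legal_move => ->. Qed.

(** Winning quantifies over all plays that follow [sigma], so a lower bound needs one such play.
    Resolver's moves in it are arbitrary. *)
Lemma complete_play_exists sigma :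
  legal_strategy sigma ->
  exists2 p, complete_play p & spoiler_follows first sigma p.
Proof.
move=> legal.
suff ex_play n : n <= #|X| ->
    exists p, [/\ uniq p, size p = n & spoiler_follows first sigma p].
  by have [p [Up szp folp]] := ex_play _ (leqnn _); exists p.
elim: n => [_|n IHn ltn]; first by exists [::]; split=> // -[].
have [p [Up szp folp]] := IHn (ltnW ltn).
have [x xp mx]: exists2 x, x \notin p & mover first p = Spoiler -> x = sigma p.
  case: (mover first p); last first.
    by exists (sigma p) => //; apply: legal; rewrite ?szp.
  have [|x xp] := @exists_notin p; first by rewrite szp.
  by exists x.
exists (rcons p x); rewrite rcons_uniq xp Up size_rcons szp; split=> // h y t.
case/lastP: t => [|t z].
  by rewrite cats1 => /rcons_inj[<- <-].
by rewrite -rcons_cons -rcons_cat => /rcons_inj[Ep _]; apply: folp Ep.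
Qed.

Lemma spoiler_won_sub (s t : seq X) :
  {subset s <= t} -> spoiler_won s -> spoiler_won t.
Proof. by move=> st won W /won[z zs zW]; exists z => //; apply: st. Qed.

Lemma spoiler_wins_within_winning k :
  spoiler_wins_within X first k -> spoiler_has_winning_strategy X first.
Proof.
case=> sigma legal won; exists sigma => // p cp fp.
by apply: spoiler_won_sub (won p cp fp) => z /mem_take.
Qed.

(** The complement of at most two Spoiler moves is a resolving set that she has not met. *)
Lemma spoiler_wins_within_ge3 k :
  (forall x y : X, x != y ->
    exists z, [/\ z != x, z != y & edge x z != edge y z]) ->
  spoiler_wins_within X first k -> 3 <= k.
Proof.
move=> third [sigma legal won]; rewrite leqNgt; apply/negP => ltk.
have [p cp fp] := complete_play_exists legal.
pose s := take k (spoiler_moves first p); have les : size s <= 2.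
  by rewrite size_take_min; apply: leq_trans (geq_minl _ _) _.
by have [z zs] := won p cp fp _ (setC_resolving third les); rewrite inE zs.
Qed.

End Play.

(** * Adjacency in [P_5] and in the product *)

Section LexicographicP5.
Variable G : sgraph.
Local Notation X := (lexprod G (path_graph 5)).
Implicit Types (g : G) (h k : 'I_5).

Let i0 : 'I_5 := @Ordinal 5 0 isT.
Let i1 : 'I_5 := @Ordinal 5 1 isT.
Let i2 : 'I_5 := @Ordinal 5 2 isT.
Let i3 : 'I_5 := @Ordinal 5 3 isT.
Let i4 : 'I_5 := @Ordinal 5 4 isT.

Lemma P5_third_resolver h h' :
  h != h' ->
  exists k, [/\ k != h, k != h' & path_edge h k != path_edge h' k].
Proof.
case: h h' => [[|[|[|[|[|//]]]]] ?] [[|[|[|[|[|//]]]]] ?] //= _;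
  by [exists i0 | exists i1 | exists i2 | exists i3 | exists i4].
Qed.

Lemma P5_neighbor h : exists2 k, k != h & path_edge h k.
Proof.
by case: h => [[|[|[|[|[|//]]]]] ?];
  [exists i1 | exists i2 | exists i3 | exists i4 | exists i3].
Qed.

Lemma P5_nonneighbor h : exists2 k, k != h & ~~ path_edge h k.
Proof.
by case: h => [[|[|[|[|[|//]]]]] ?];
  [exists i2 | exists i3 | exists i4 | exists i0 | exists i0].
Qed.

(** Inside one layer the third vertex comes from [P_5]. Otherwise it lies in the layer of [x], at a
    non-neighbour of [h] if [g] and [g'] are adjacent and at a neighbour if not. *)
Lemma lexP5_third_resolver (x y : X) :
  x != y -> exists z, [/\ z != x, z != y & edge x z != edge y z].
Proof.
case: x y => g h [g' h'] xy.
have [Eg|gg'] := eqVneq g g'.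
  rewrite -Eg in xy *.
  have [|k [kh kh' ek]] := @P5_third_resolver h h'.
    by apply: contraNneq xy => ->.
  exists (g, k); split; rewrite ?xpair_eqE ?eqxx //=.
  by rewrite /lex_edge /= edge_irrefl eqxx.
case egg': (edge g g').
  have [k kh ek] := P5_nonneighbor h.
  exists (g, k); split; rewrite ?xpair_eqE ?eqxx ?(negPf gg') //=.
  by rewrite /lex_edge /= edge_irrefl eqxx /= edge_sym egg' (negPf ek).
have [k kh ek] := P5_neighbor h.
exists (g, k); split; rewrite ?xpair_eqE ?eqxx ?(negPf gg') //=.
rewrite /lex_edge /= edge_irrefl eqxx /= edge_sym egg' ek.
by rewrite [g' == g]eq_sym (negPf gg').
Qed.

(** * Distances in the product *)

(* The steps of a walk made inside its first layer can be skipped. *)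
Lemma lex_walk_change_start (H : sgraph) (g : G) (a b : H)
    (p : seq (lexprod G H)) :
  path (@edge (lexprod G H)) (g, a) p -> (last (g, a) p).1 != g ->
  exists q, [/\ size q <= size p, path (@edge (lexprod G H)) (g, b) q
              & last (g, b) q = last (g, a) p].
Proof.
elim: p a => [|[g' c] p IHp] a /=; first by rewrite eqxx.
case/andP=> eac pathp lastp.
(* A first step leaving layer [g] is available from [b] as well; one inside the layer is dropped. *)
case/orP: eac => [/= egg'|/= /andP[/eqP Eg _]].
  by exists ((g', c) :: p); split; rewrite //= pathp /lex_edge /= egg'.
rewrite -Eg in pathp lastp *.
by have [q [szq pathq lastq]] := IHp _ pathp lastp; exists q; split; rewrite // ltnW.
Qed.

Lemma dist_other_layer (H : sgraph) g (a b : H) (z : lexprod G H) :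
  z.1 != g ->
  dist ((g, a) : lexprod G H) z = dist ((g, b) : lexprod G H) z.
Proof.
move=> zg; apply: least_mono => _ [p [<- pathp lastp]].
  have [|q [szq pathq lastq]] := lex_walk_change_start b pathp.
    by rewrite lastp.
  by exists (size q) => //; exists q; rewrite lastq.
have [|q [szq pathq lastq]] := lex_walk_change_start a pathp.
  by rewrite lastp.
by exists (size q) => //; exists q; rewrite lastq.
Qed.

Hypotheses (G_connected : connected_graph G) (G_ge2 : 2 <= #|G|).

(** Any vertex of an adjacent layer is a common neighbour of all of layer [g], so distances inside
    the layer are at most 2 and adjacency decides them. *)
Lemma dist_same_layer g h h' k :
  k != h -> k != h' -> path_edge h k = path_edge h' k ->
  dist ((g, h) : X) (g, k) = dist ((g, h') : X) (g, k).
Proof.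
move=> kh kh' ek.
have edgeE a : edge ((g, a) : X) (g, k) = path_edge a k.
  by rewrite /= /lex_edge /= edge_irrefl eqxx.
case ehk: (path_edge h k).
  by rewrite !dist_edge ?edgeE -?ek ?ehk.
have [g' egg'] := exists_neighbor g G_connected G_ge2.
have dist2 a : k != a -> ~~ path_edge a k -> dist ((g, a) : X) (g, k) = Some 2.
  move=> ka eak; apply: (@dist_common_neighbor X _ _ (g', k)).
  - by rewrite xpair_eqE eqxx eq_sym.
  - by rewrite edgeE.
  - by rewrite /= /lex_edge /= egg'.
  by rewrite /= /lex_edge /= edge_sym egg'.
by rewrite !dist2 -?ek ?ehk.
Qed.

(** The list [s] contains every vertex resolving the chosen pair, hence meets every resolving
    set. *)
Lemma spoiler_won_layer g h h' (s : seq X) :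
  h != h' ->
  (forall k, (g, k) \notin s ->
    [/\ k != h, k != h' & path_edge h k = path_edge h' k]) ->
  spoiler_won s.
Proof.
move=> hh' unres W /(_ (g, h) (g, h'))[].
  by case=> Eh; rewrite Eh eqxx in hh'.
move=> [g' k] kW dk; exists (g', k) => //; apply: contra_notT dk => ks.
have [Eg|gg'] := eqVneq g' g; last exact: dist_other_layer.
by rewrite Eg in ks *; have [? ? ?] := unres k ks; apply: dist_same_layer.
Qed.

(** * Spoiler's strategy inside one layer *)

(* [opposite] is the antipode in the 4-cycle 0-1-4-3, with a dummy value at 2. *)
Definition opposite k : 'I_5 := if k == i2 then i0 else rev_ord k.

(** Neighbours in the 4-cycle 0-1-4-3, again with a dummy value at 2. *)
Definition cycle_neighbors k : 'I_5 * 'I_5 :=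
  if (k == i0) || (k == i4) then (i1, i3) else (i0, i4).

Lemma spoiler_won_triple g k c :
  k != i2 -> (c == (cycle_neighbors k).1) || (c == (cycle_neighbors k).2) ->
  @spoiler_won X [:: (g, i2); (g, k); (g, c)].
Proof.
(* Reduces each triple to naming a pair that no other vertex of the layer resolves; the five
   positions are then tested by computation. *)
have chk h h' : h != h' ->
    all (fun j => (j \notin [:: i2; k; c]) ==>
      [&& j != h, j != h' & path_edge h j == path_edge h' j])
      [:: i0; i1; i2; i3; i4] ->
    @spoiler_won X [:: (g, i2); (g, k); (g, c)].
  move=> hh' /allP all5; apply: (@spoiler_won_layer g h h') => // j.
  rewrite !inE !xpair_eqE eqxx /= => jn.
  have /all5: j \in [:: i0; i1; i2; i3; i4].
    by case: j {jn} => [[|[|[|[|[|//]]]]] ?].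
  by rewrite !inE jn => /and3P[? ? /eqP].
move=> k2 kc; move: k k2 kc chk => [[|[|[|[|[|//]]]]] lt5] //= _;
  case/orP=> /eqP-> chk.
- by apply: (chk i0 i1).
- by apply: (chk i0 i2).
- by apply: (chk i0 i1).
- by apply: (chk i2 i4).
- by apply: (chk i0 i2).
- by apply: (chk i3 i4).
- by apply: (chk i2 i4).
- by apply: (chk i3 i4).
Qed.

(** The list is read as starting with Spoiler's first move, so [s1] is her second. Of [r0] only the
    second coordinate is used, whatever its layer. *)
Definition spoiler_plan g (h : seq X) : X :=
  match h with
  | [:: _, _, s1 & _] =>
      let: (a, b) := cycle_neighbors s1.2 in
      if (g, a) \notin h then (g, a) else (g, b)
  | [:: _, r0 & _] => (g, opposite r0.2)
  | _ => (g, i2)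
  end.

(* [h] holds the moves made before Spoiler opens layer [g]. *)
Lemma spoiler_plan_wins g (h : seq X) (s0 r0 s1 r1 s2 : X) :
  {in h, forall x, x.1 != g} ->
  uniq (h ++ [:: s0; r0; s1; r1; s2]) ->
  s0 = legal_move h (spoiler_plan g [::]) ->
  s1 = legal_move (h ++ [:: s0; r0]) (spoiler_plan g [:: s0; r0]) ->
  s2 = legal_move (h ++ [:: s0; r0; s1; r1])
         (spoiler_plan g [:: s0; r0; s1; r1]) ->
  spoiler_won [:: s0; s1; s2].
Proof.
move=> hg; rewrite cat_uniq => /and3P[_ _ U].
have notin_h k : (g, k) \notin h.
  by apply/negP => /hg; rewrite eqxx.
rewrite (legal_move_id (notin_h i2)) => E0; rewrite {}E0 in U *.
have r0n2 : r0 != (g, i2).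
  by move: U; rewrite /= !inE; case: eqVneq.
have opp2 k : opposite k != i2 by case: k => [[|[|[|[|[|//]]]]] ?].
(* [opposite] has no fixed point, so [r0] cannot occupy Spoiler's second vertex. *)
have oppr0 : r0 != (g, opposite r0.2).
  case: r0 r0n2 {U} => g' k; rewrite !xpair_eqE; case: eqP => //= _.
  by case: k => [[|[|[|[|[|//]]]]] ?].
rewrite legal_move_id; last first.
  rewrite mem_cat negb_or notin_h !inE negb_or xpair_eqE eqxx opp2 /=.
  by rewrite eq_sym.
move=> E1; rewrite {}E1 /spoiler_plan [in cycle_neighbors _]/=.
set w := opposite r0.2 in U oppr0 *.
(* If [r0] lies in layer [g], it is opposite to [w] on the cycle and thus no neighbour of [w]; in
   another layer it blocks nothing. *)
have nbr_free c : (c == (cycle_neighbors w).1) || (c == (cycle_neighbors w).2) ->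
    [/\ c != i2, c != w & (g, c) != r0].
  rewrite eq_sym [c == (_).2]eq_sym /w => cw; clear -cw r0n2.
  case: r0 r0n2 cw => g' k; rewrite !xpair_eqE eq_sym.
  have [_|_] := eqVneq g g'; last first.
    by move=> _; case: k => [[|[|[|[|[|//]]]]] ?] /= /orP[]/eqP<-.
  by case: k => [[|[|[|[|[|//]]]]] ?] //= _ /orP[]/eqP<-.
case Ew: (cycle_neighbors w) => [a b].
have ab : a != b.
  by move: Ew; rewrite /cycle_neighbors; case: ifP => _ [<- <-].
rewrite Ew /= in nbr_free.
have [a2 aw ar0] : [/\ a != i2, a != w & (g, a) != r0].
  by apply: nbr_free; rewrite eqxx.
have [b2 bw br0] : [/\ b != i2, b != w & (g, b) != r0].
  by apply: nbr_free; rewrite eqxx orbT.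
have memE c : c != i2 -> c != w -> (g, c) != r0 ->
    ((g, c) \in [:: (g, i2); r0; (g, w); r1]) = ((g, c) == r1).
  move=> c2 cw cr0; rewrite !inE !xpair_eqE eqxx /=.
  by rewrite (negPf c2) (negPf cw) (negPf cr0).
(* [r1] blocks at most one of the two threats, and Spoiler carries out the other. *)
rewrite memE //; case: ifPn => [ar1|/negbNE/eqP ar1].
  rewrite legal_move_id; last by rewrite mem_cat negb_or notin_h memE.
  by move=> ->; apply: spoiler_won_triple; rewrite ?opp2 ?Ew ?eqxx.
rewrite legal_move_id; last first.
  by rewrite mem_cat negb_or notin_h memE // -ar1 xpair_eqE eqxx eq_sym.
by move=> ->; apply: spoiler_won_triple; rewrite ?opp2 ?Ew ?eqxx ?orbT.
Qed.

(** * The exact number of moves *)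

(** When Resolver starts, Spoiler's third move is the sixth of the play, so no complete play ends
    before it. *)
Lemma card_lexP5_ge : 6 <= #|X|.
Proof. by rewrite card_prod card_ord (leq_trans _ (leq_mul G_ge2 (leqnn 5))). Qed.

Lemma spoiler_wins_within3 first : spoiler_wins_within X first 3.
Proof.
have [g0 _]: exists g0 : G, g0 \in G by apply/card_gt0P; apply: ltnW.
have card6 := card_lexP5_ge.
case: first.
  (* Resolver's opening move touches a single layer; Spoiler opens a different one. *)
  pose other g := odflt g [pick g' | g' != g].
  have otherP g : other g != g.
    rewrite /other; case: pickP => // all_g.
    have [g' egg'] := exists_neighbor g G_connected G_ge2.
    by have /eqP Eg := negbFE (all_g g'); rewrite Eg edge_irrefl in egg'.
  (* [behead] removes Resolver's opening move; the default [(g0, i0)] concerns only the empty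
     history, where Spoiler is not to move. *)
  pose plan (h : seq X) := spoiler_plan (other (head (g0, i0) h).1) (behead h).
  exists (fun h : seq X => legal_move h (plan h)).
    exact: legal_move_legal.
  case=> [|r [|s0 [|r0 [|s1 [|r1 [|s2 t]]]]]] [Up szp] fol;
    try by move: card6; rewrite -szp.
  rewrite /spoiler_moves /= take0.
  apply: (@spoiler_plan_wins (other r.1) [:: r] s0 r0 s1 r1 s2).
  - by move=> x; rewrite inE => /eqP->; rewrite eq_sym.
  - move: Up; rewrite -[_ :: _]/([:: r; s0; r0; s1; r1; s2] ++ t).
    by rewrite cat_uniq => /andP[].
  - exact: (fol [:: r] s0 [:: r0, s1, r1, s2 & t]).
  - exact: (fol [:: r; s0; r0] s1 [:: r1, s2 & t]).
  exact: (fol [:: r; s0; r0; s1; r1] s2 t).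
exists (fun h : seq X => legal_move h (spoiler_plan g0 h)).
  exact: legal_move_legal.
case=> [|s0 [|r0 [|s1 [|r1 [|s2 t]]]]] [Up szp] fol;
  try by move: card6; rewrite -szp.
rewrite /spoiler_moves /=; have -> s : take 0 s = [::] :> seq X by case: s.
apply: (@spoiler_plan_wins g0 [::] s0 r0 s1 r1 s2) => //.
- move: Up; rewrite -[_ :: _]/([:: s0; r0; s1; r1; s2] ++ t).
    by rewrite cat_uniq => /andP[].
- exact: (fol [::] s0 [:: r0, s1, r1, s2 & t]).
- exact: (fol [:: s0; r0] s1 [:: r1, s2 & t]).
exact: (fol [:: s0; r0; s1; r1] s2 t).
Qed.

Lemma spoiler_number_lexP5 first : spoiler_number X first = Some 3.
Proof.
apply: least_eq => [|k]; first exact: spoiler_wins_within3.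
exact/spoiler_wins_within_ge3/lexP5_third_resolver.
Qed.

End LexicographicP5.

Theorem theorem5p3 (G : sgraph) (G_connected : connected_graph G)
    (G_ge2 : 2 <= #|G|) :
  [/\ outcome_S (lexprod G (path_graph 5)),
      S_MB' (lexprod G (path_graph 5)) = S_MB (lexprod G (path_graph 5))
    & S_MB (lexprod G (path_graph 5)) = Some 3].
Proof.
split; rewrite /S_MB' /S_MB ?spoiler_number_lexP5 // => first.
exact/spoiler_wins_within_winning/spoiler_wins_within3.
Qed.
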